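(* Fix integers $k\ge3$, $q\ge2$ and $L\ge2$. There is a finite $k$-uniform hypergraph $H=(V,E)$ of girth greater than $L$, with no isolated vertices, such that, writing $N=|V|$: 1. every $U\subseteq V$ with $|U|\ge N/q$ contains a hyperedge; 2. every nonempty $S\subseteq V$ with $|S|\le(1-1/q)N$ has a hyperedge meeting it in exactly one vertex (that is, there is $e\in E$ with $|e\cap S|=1$).
   Context: A $k$-uniform hypergraph $H=(V,E)$ consists of a vertex set $V$ and a set $E$ of $k$-element subsets of $V$ (hyperedges). A vertex is isolated if it lies in no hyperedge. Girth means Berge girth: a cycle of length $\ell\ge2$ consists of $\ell$ distinct vertices $v_1,\dots,v_\ell$ and $\ell$ distinct hyperedges $e_1,\dots,e_\ell$ in alternating incidence, i.e. $v_i,v_{i+1}\in e_i$ for all $i$ (indices cyclic). The girth is the length of a shortest cycle, or infinity if there is none. *)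

(* Defs.v *)
From mathcomp Require Import all_boot all_order all_algebra.

Set Implicit Arguments.
Unset Strict Implicit.
Unset Printing Implicit Defensive.

(* A finite hypergraph is given by a finite type T of vertices (all of T is
   the vertex set) and a set E : {set {set T}} of hyperedges. *)
Section Hypergraph.
Variable T : finType.
Implicit Types E : {set {set T}}.

Definition uniform (k : nat) E : bool := [forall e in E, #|e| == k].

Definition isolated E (x : T) : bool := [forall e in E, x \notin e].

Definition is_cycle E l (v : {ffun 'I_l -> T}) (e : {ffun 'I_l -> {set T}}) :
    bool :=
  [&& 1 < l, injectiveb v, injectiveb e
    & [forall i, [&& e i \in E, v i \in e i & v (ordS i) \in e i]]].

Definition has_cycle E l : bool := [exists v, exists e, @is_cycle E l v e].

(* None stands for infinity. The vertices of a cycle are distinct, so every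
   cycle length lies between 2 and #|T|: see has_cycle_bounds. *)
Definition girth E : option nat :=
  ohead [seq l <- iota 2 #|T|.-1 | has_cycle E l].

Definition girth_gt E (L : nat) : bool :=
  if girth E is Some g then L < g else true.

Lemma has_cycle_bounds E l : has_cycle E l -> 1 < l <= #|T|.
Proof.
case/existsP=> v /existsP[e /and4P[-> /injectiveP vI _ _]] /=.
by rewrite -(card_ord l); exact: leq_card vI.
Qed.

Lemma girth_gtP E L :
  reflect (forall l, l <= L -> ~~ has_cycle E l) (girth_gt E L).
Proof.
have memc l : (l \in [seq l <- iota 2 #|T|.-1 | has_cycle E l]) = has_cycle E l.
  rewrite mem_filter mem_iota; case: (boolP (has_cycle E l)) => //=.
  by case/has_cycle_bounds/andP=> l1 lT; rewrite l1; case: #|T| lT => [|n] //=; case: l l1.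
have srt : sorted ltn [seq l <- iota 2 #|T|.-1 | has_cycle E l].
  by rewrite sorted_filter ?iota_ltn_sorted //; exact: ltn_trans.
rewrite /girth_gt /girth.
case: [seq _ <- _ | _] memc srt => [|g s] memc /= srt.
  by left=> l _; rewrite -memc.
apply: (iffP idP) => [Lg l lL | noc].
  rewrite -memc inE negb_or; apply/andP; split.
    by rewrite ltn_eqF // (leq_ltn_trans lL).
  apply: contraL lL => ls; rewrite -ltnNge (ltn_trans Lg) //.
  by move: (order_path_min ltn_trans srt) => /allP; exact.
by rewrite ltnNge; apply/negP=> /noc; rewrite -memc mem_head.
Qed.

End Hypergraph.

(* Main.v *)
Require Import Defs.
From mathcomp Require Import all_boot all_order all_algebra.
From mathcomp Require Import zify.
Import Order.TTheory GRing.Theory Num.Theory.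

(** Call a set S stopping if no edge meets it in exactly one vertex. The second
    property asks that no nonempty stopping set has size at most (1 - 1/q)N.

    The construction starts from a hypergraph of girth greater than L in which,
    for all sets A and B that each contain a fraction 1/r of the N vertices
    (here r = 2q), some edge has one vertex in A and all its other vertices
    in B ([exists_mixing_hypergraph]). Taking A = B gives an edge inside every
    large set; taking for B the complement of A shows that a stopping set has
    size either below N/r or above (1 - 1/r)N. Only small stopping sets are
    then in the way. They are removed all at once: a union of stopping sets is
    stopping ([stoppingU]), and a union of two small ones is too small to be
    large, hence is small again. So the union S0 of all small stopping sets is
    itself small and stopping. Delete S0 and keep the edges that avoid it. If S
    is stopping in what remains, then the union of S0 and S is stopping in the
    original hypergraph, because an edge through S0 already meets S0 twice
    ([stopping_delete]). By maximality of S0 this union is large when S is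
    nonempty, so S is large. Since S0 has less than half of the vertices,
    passing from r = 2q to q absorbs the loss.

    The first hypergraph is built greedily, one edge at a time, with a bound d
    on all degrees. At each step the next edge must avoid the vertices of
    degree d, which are few because there are at most CN edges in total, and
    its vertices must be at distance more than L from one another, which keeps
    the girth above L ([girth_gt_add]) and forbids only boundedly many vertices
    at each choice. Each large A or B therefore still has at least N/(2r) allowed
    vertices, and choosing the vertices one by one, each time the allowed vertex
    that serves the most remaining pairs (A, B) ([exists_popular_point]), gives
    an edge that serves a fraction 1/D of the pairs not served so far, where
    D = (2r)^k. After CN steps at most 4^N (1 - 1/D)^(CN) pairs remain, which is
    less than one for a suitable constant C. *)

Set Implicit Arguments.
Unset Strict Implicit.
Unset Printing Implicit Defensive.

(** * Choosing popular vertices by averaging *)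

Section Averaging.
Variables T I : finType.
Implicit Types (F : {set I}) (A : I -> {set T}) (Z : {set T}).

(** Double counting: each A i has at least a fraction 1/c of T outside Z, so the
    points outside Z lie on average in a fraction 1/c of the sets A i. *)
Lemma exists_popular_point F A Z c :
    0 < #|T| -> F != set0 -> (forall i, i \in F -> #|T| <= c * #|A i :\: Z|) ->
  exists2 x, x \notin Z & #|F| <= c * #|[set i in F | x \in A i]|.
Proof.
move=> T0 F0 HA.
suff /existsP[x /andP[xZ Hx]] :
    [exists x, (x \notin Z) && (#|F| <= c * #|[set i in F | x \in A i]|)].
  by exists x.
rewrite -[X in is_true X]negbK negb_exists; apply/negP => /forallP H.
have F0' : 0 < #|F| by rewrite card_gt0.
have dc : \sum_(i in F) #|A i :\: Z|
          = \sum_(x | x \notin Z) #|[set i in F | x \in A i]|.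
  under eq_bigr do rewrite -sum1_card big_mkcond /=.
  rewrite exchange_big /= [RHS]big_mkcond /=; apply: eq_bigr => x _.
  case: ifPn => xZ.
    rewrite -sum1_card [RHS]big_mkcond /= big_mkcond /=; apply: eq_bigr => i _.
    by rewrite !inE xZ /=; case: (i \in F).
  by rewrite big1 // => i _; rewrite !inE (negbTE xZ).
have lo : #|F| * #|T| <= c * \sum_(i in F) #|A i :\: Z|.
  rewrite big_distrr /= -sum_nat_const; exact: leq_sum.
have hi : c * (\sum_(i in F) #|A i :\: Z|) <= #|T| * #|F|.-1.
  rewrite dc big_distrr /= -sum_nat_const big_mkcond /=; apply: leq_sum => x _.
  case: ifP => // xZ; have := H x; rewrite xZ /= -ltnNge; lia.
by move: (leq_trans lo hi); nia.
Qed.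

(** Iterates [exists_popular_point], adding excl x to the forbidden set after each
    choice of x and keeping only the indices that x serves. The number z bounds
    the size that the forbidden set can reach. *)
Lemma exists_popular_seq (excl : T -> {set T}) b c z A :
    0 < #|T| -> (forall x, #|excl x| <= b) ->
  forall n F Z, F != set0 -> #|Z| + n * b <= z ->
    (forall i Z', i \in F -> #|Z'| <= z -> #|T| <= c * #|A i :\: Z'|) ->
  exists s, [/\ size s = n, {in s, forall x, x \notin Z},
    pairwise (fun x y => y \notin excl x) s
    & #|F| <= c ^ n * #|[set i in F | all (mem (A i)) s]|].
Proof.
move=> T0 exb; elim=> [|n IHn] F Z F0 Zz HA.
  exists [::]; split=> //; rewrite expn0 mul1n; apply: subset_leq_card.
  by apply/subsetP=> i iF; rewrite inE iF.
have [|x xZ Fx] := @exists_popular_point F A Z c T0 F0.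
  by move=> i iF; apply: HA => //; apply: leq_trans Zz; exact: leq_addr.
set F' := [set i in F | x \in A i] in Fx.
have F'0 : F' != set0.
  apply: contraNneq F0 => F'0; move: Fx.
  by rewrite F'0 cards0 muln0 leqn0 cards_eq0.
have [||s [sz sZ sp Fs]] := IHn F' (Z :|: excl x) F'0.
- apply: leq_trans Zz; rewrite mulSn addnA leq_add2r.
  apply: leq_trans (leq_card_setU _ _) _; by rewrite leq_add2l.
- by move=> i Z'; rewrite inE => /andP[iF _]; exact: HA.
exists (x :: s); split=> /=.
- by rewrite sz.
- move=> y; rewrite inE => /orP[/eqP-> //|/sZ].
  by rewrite inE negb_or => /andP[].
- rewrite sp andbT; apply/allP=> y /sZ.
  by rewrite inE negb_or => /andP[].
- apply: leq_trans Fx _; rewrite expnS -mulnA leq_mul2l; apply/orP; right.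
  apply: leq_trans Fs _; rewrite leq_mul2l; apply/orP; right.
  by apply: subset_leq_card; apply/subsetP=> i; rewrite !inE -andbA.
Qed.

End Averaging.

(** * Balls, degrees and girth *)

Section Balls.
Variable T : finType.
Implicit Types (E : {set {set T}}) (e : {set T}).

Definition edges_at E x := [set e in E | x \in e].
Definition nbhd E x := x |: cover (edges_at E x).
(** As [nbhd E x] contains x, this is the set of points joined to x by a walk of
    at most n edges. *)
Fixpoint ball E n x :=
  if n is n'.+1 then \bigcup_(y in ball E n' x) nbhd E y else [set x].

Lemma nbhdP E x y :
  reflect (x = y \/ exists2 e, e \in E & (x \in e) && (y \in e)) (y \in nbhd E x).
Proof.
rewrite in_setU1 eq_sym; apply: (iffP orP) => -[].
- by move/eqP; left.
- case/bigcupP=> e; rewrite inE => /andP[eE xe] ye; right; exists e => //.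
  by rewrite xe.
- by move=> ->; left.
- case=> e eE /andP[xe ye]; right; apply/bigcupP; exists e => //.
  by rewrite inE eE.
Qed.

Lemma nbhd_sym E x y : (y \in nbhd E x) = (x \in nbhd E y).
Proof.
by apply/nbhdP/nbhdP => -[->|[e eE]]; [left | rewrite andbC; right; exists e
  | left | rewrite andbC; right; exists e].
Qed.

Lemma ball_trans E m n x y z :
  y \in ball E m x -> z \in ball E n y -> z \in ball E (m + n) x.
Proof.
move=> yx; elim: n z => [|n IHn] z /=; first by rewrite inE addn0 => /eqP->.
by case/bigcupP=> u /IHn ux zu; rewrite addnS; apply/bigcupP; exists u.
Qed.

Lemma ball_sym E n x y : y \in ball E n x -> x \in ball E n y.
Proof.
elim: n y => [|n IHn] y /=; first by rewrite !inE eq_sym.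
case/bigcupP=> z /IHn xz; rewrite nbhd_sym => zy.
rewrite -[_ \in _]/(x \in ball E n.+1 y) -add1n; apply: (ball_trans _ xz).
by rewrite /= big_set1.
Qed.

Lemma ball_center E n x : x \in ball E n x.
Proof.
elim: n => [|n IHn] /=; first by rewrite inE.
by apply/bigcupP; exists x => //; rewrite setU11.
Qed.

Lemma leq_ball E m n x : m <= n -> ball E m x \subset ball E n x.
Proof.
move=> mn; apply/subsetP=> y yx; rewrite -(subnKC mn).
by apply: ball_trans yx _; exact: ball_center.
Qed.

Lemma card_bigcup_leq (A : {set T}) (G : T -> {set T}) b :
  (forall x, #|G x| <= b) -> #|\bigcup_(x in A) G x| <= #|A| * b.
Proof.
move=> Gb; rewrite -sum_nat_const.
apply: (@leq_trans (\sum_(x in A) #|G x|)); last exact: leq_sum.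
by elim/big_rec2: _ => [|x n S _ IH]; rewrite ?cards0 //;
  apply: leq_trans (leq_card_setU _ _) _; rewrite leq_add2l.
Qed.

Lemma card_nbhd E k d x :
  uniform k E -> #|edges_at E x| <= d -> #|nbhd E x| <= (d * k).+1.
Proof.
move=> /forall_inP uE dx; rewrite cardsU1 -add1n leq_add //; first by case: (_ \notin _).
apply: (@leq_trans (\sum_(e in edges_at E x) #|e|)); first exact: leq_card_cover.
apply: (@leq_trans (\sum_(e in edges_at E x) k)).
  by apply: leq_sum => e; rewrite inE => /andP[/uE/eqP->].
by rewrite sum_nat_const leq_mul2r dx orbT.
Qed.

Lemma card_ball E k d n x :
    uniform k E -> (forall y, #|edges_at E y| <= d) ->
  #|ball E n x| <= (d * k).+1 ^ n.
Proof.
move=> uE dE; elim: n => [|n IHn] /=; first by rewrite cards1.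
rewrite expnSr; apply: (@leq_trans (#|ball E n x| * (d * k).+1)).
  by apply: card_bigcup_leq => y; exact: card_nbhd (dE y).
by rewrite leq_mul2r IHn orbT.
Qed.

(** The degrees sum to k #|E|, so few vertices have degree d or more. *)
Lemma card_crowded E k d :
  uniform k E -> d * #|[set x | d <= #|edges_at E x|]| <= #|E| * k.
Proof.
move=> /forall_inP uE; set H := [set x | _].
have -> : #|E| * k = \sum_x #|edges_at E x|.
  rewrite -sum_nat_const; under [RHS]eq_bigr do rewrite -sum1_card big_mkcond /=.
  rewrite exchange_big /= big_mkcond /=; apply: eq_bigr => e _.
  case: ifPn => eE; last by rewrite big1 // => x _; rewrite inE (negbTE eE).
  rewrite -(eqP (uE e eE)) -sum1_card big_mkcond /=; apply: eq_bigr => x _.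
  by rewrite inE eE.
rewrite mulnC -sum_nat_const big_mkcond /=; apply: leq_sum => x _.
by rewrite inE; case: ifP.
Qed.

Lemma iter_ordS l j (i : 'I_l) : iter j (@ordS l) i = (i + j) %% l :> nat.
Proof.
elim: j => [|j IHj] /=; first by rewrite addn0 modn_small.
by rewrite IHj -addn1 modnDml addn1 addnS.
Qed.

Lemma iter_ordS_neq l j (i : 'I_l) : 0 < j < l -> iter j (@ordS l) i != i.
Proof.
case/andP=> j0 jl; rewrite -val_eqE /= iter_ordS -[X in _ != X](@modn_small _ l) //.
by rewrite -[X in _ != X %[mod _]]addn0 eqn_modDl mod0n modn_small // -lt0n.
Qed.

(** A cycle of length l <= L through the new edge e uses e only once; the l - 1
    other edges form a walk between two vertices of e, which would then be at
    distance less than L. *)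
Lemma girth_gt_add E e L :
    girth_gt E L ->
    {in e &, forall x y, x != y -> y \notin ball E L x} ->
  girth_gt (e |: E) L.
Proof.
move=> /girth_gtP gE sp; apply/girth_gtP => l lL; apply/negP.
case/existsP=> v /existsP[w /and4P[l1 /injectiveP vI /injectiveP wI /forallP inc]].
have [/existsP[i /eqP wi]|/existsPn nw] := boolP [exists i, w i == e]; last first.
  move/negP: (gE l lL); apply; apply/existsP; exists v; apply/existsP; exists w.
  apply/and4P; split=> //; [exact/injectiveP|exact/injectiveP|].
  apply/forallP=> i; have /and3P[] := inc i.
  by rewrite in_setU1 (negbTE (nw i)) /= => -> -> ->.
(* Walk around the cycle from ordS i; the edges used differ from e = w i. *)
have step j : j < l ->
    v (iter j.+1 (@ordS l) i) \in ball E j (v (ordS i)).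
  elim: j => [|j IHj] jl; first by rewrite inE.
  apply/bigcupP; exists (v (iter j.+1 (@ordS l) i)); first exact: IHj (ltnW jl).
  apply/nbhdP; right; exists (w (iter j.+1 (@ordS l) i)).
    have /and3P[] := inc (iter j.+1 (@ordS l) i).
    by rewrite in_setU1 -wi => /orP[/eqP/wI/eqP|//]; rewrite (negbTE (iter_ordS_neq _ _)).
  by have /and3P[_ -> ] := inc (iter j.+1 (@ordS l) i).
have li : iter l (@ordS l) i = i.
  by apply: val_inj; rewrite /= iter_ordS modnDr modn_small.
have iSi : v (ordS i) != v i.
  by rewrite (inj_eq vI) (@iter_ordS_neq _ 1).
have /and3P[_ vie vSe] := inc i; rewrite wi in vie vSe.
have /negP[] := sp _ _ vSe vie iSi.
have : v i \in ball E l.-1 (v (ordS i)).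
  have := step l.-1; rewrite prednK ?li; [by apply; lia | lia].
by apply: (subsetP (leq_ball _ _ _)); lia.
Qed.
End Balls.

(** * Greedy construction of a mixing hypergraph *)

Section Greedy.
Variable T : finType.
Implicit Types (E : {set {set T}}) (e : {set T}) (F : {set {set T} * {set T}}).

Definition hits e (P : {set T} * {set T}) :=
  [exists x in e, (x \in P.1) && (e :\ x \subset P.2)].

Definition missed F E := [set P in F | [forall e in E, ~~ hits e P]].

Lemma leq_card_setD_half r (A Z : {set T}) :
  #|T| <= r * #|A| -> 2 * r * #|Z| <= #|T| -> #|T| <= 2 * r * #|A :\: Z|.
Proof.
move=> TA ZT; have := cardsID Z A; have := subset_leq_card (subsetIr A Z); nia.
Qed.

(** One greedy step. The sum in the hypothesis bounds the number of vertices that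
    are ever forbidden: those of degree d, and the balls around the vertices
    already chosen. The first vertex is chosen for the sets P.1, the k others
    for the sets P.2. *)
Lemma exists_good_edge E F k d L r :
    0 < #|T| -> uniform k.+1 E -> (forall x, #|edges_at E x| <= d) ->
    2 * r * (#|[set x | d <= #|edges_at E x|]| + k.+1 * (d * k.+1).+1 ^ L)
      <= #|T| ->
    F != set0 ->
    (forall P, P \in F -> #|T| <= r * #|P.1| /\ #|T| <= r * #|P.2|) ->
  exists e, [/\ #|e| = k.+1, {in e, forall x, #|edges_at E x| < d},
    {in e &, forall x y, x != y -> y \notin ball E L x}
    & #|F| <= (2 * r) ^ k.+1 * #|[set P in F | hits e P]|].
Proof.
move=> T0 uE dE; set H := [set x | _]; set b := _ ^ L => room F0 FT.
have cb x : #|ball E L x| <= b by exact: card_ball.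
have [|x xH Fx] := @exists_popular_point _ _ F (fun P => P.1) H (2 * r) T0 F0.
  move=> P /FT[P1 _]; apply: (leq_card_setD_half P1).
  by apply: leq_trans room; rewrite leq_mul2l leq_addr orbT.
set F' := [set P in F | _] in Fx.
have F'0 : F' != set0.
  apply: contraNneq F0 => F'0; move: Fx.
  by rewrite F'0 cards0 muln0 leqn0 cards_eq0.
have [||s [sz sH sp Fs]] := @exists_popular_seq _ _ (ball E L) b (2 * r)
    (#|H| + k.+1 * b) (fun P => P.2) T0 cb k F' (H :|: ball E L x) F'0.
- by have [+ _] := leq_card_setU H (ball E L x); have := cb x; rewrite mulSn; lia.
- move=> P Z'; rewrite inE => /andP[/FT[_ P2] _] Zz.
  apply: (leq_card_setD_half P2).
  by apply: leq_trans room; rewrite leq_mul2l Zz orbT.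
have {sp} xsp : pairwise (fun u v => v \notin ball E L u) (x :: s).
  rewrite /= sp andbT; apply/allP=> y /sH.
  by rewrite inE negb_or => /andP[].
have xsH y : y \in x :: s -> #|edges_at E y| < d.
  rewrite inE => /orP[/eqP->|/sH]; first by move: xH; rewrite inE -ltnNge.
  by rewrite !inE negb_or -ltnNge => /andP[].
have usx : uniq (x :: s).
  rewrite uniq_pairwise; apply: sub_pairwise xsp => u v /=.
  by apply: contraNneq => ->; exact: ball_center.
exists [set:: x :: s]; split.
- by rewrite cardsE (card_uniqP usx) /= sz.
- by move=> y; rewrite inE => /xsH.
- move=> u v; rewrite !inE -![_ || _]/(_ \in x :: s) => us vs uv.
  pose i := index u (x :: s); pose j := index v (x :: s).
  have si : i < size (x :: s) by rewrite index_mem.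
  have sj : j < size (x :: s) by rewrite index_mem.
  move/(pairwiseP x): xsp => far.
  have := far i j si sj; have := far j i sj si; rewrite /i /j !nth_index //.
  case: (ltngtP (index u (x :: s)) (index v (x :: s))) => [_ _ ->//|_ + _|ij].
    by move=> /(_ isT); apply: contraNN => /ball_sym.
  by move: uv; rewrite -(nth_index x us) ij nth_index // eqxx.
apply: leq_trans Fx _; rewrite expnS -[X in _ <= X]mulnA leq_mul2l; apply/orP; right.
apply: leq_trans Fs _; rewrite leq_mul2l; apply/orP; right.
apply: subset_leq_card; apply/subsetP=> P; rewrite !inE -andbA.
case/and3P=> -> xP1 /allP sP2 /=; apply/existsP; exists x.
rewrite inE mem_head xP1 /=; apply/subsetP=> y.
by rewrite !inE => /andP[/negbTE->] /sP2.
Qed.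

(** The lower bound on d makes the number of vertices of degree d at most
    #|T| / (4 r), as the number of edges stays below C #|T|; the lower bound on
    #|T| does the same for the union of the balls. Together they forbid at most
    #|T| / (2 r) vertices, as [exists_good_edge] requires. *)
Lemma exists_greedy_hypergraph k d C D L r F :
    0 < #|T| -> D = (2 * r) ^ k.+1 ->
    4 * r * k.+1 * C <= d -> 4 * r * k.+1 * (d * k.+1).+1 ^ L <= #|T| ->
    0 < C ->
    (forall P, P \in F -> #|T| <= r * #|P.1| /\ #|T| <= r * #|P.2|) ->
  forall t, t <= C * #|T| -> exists E,
    [/\ uniform k.+1 E, girth_gt E L, forall x, #|edges_at E x| <= d,
        #|E| <= t & D ^ t * #|missed F E| <= D.-1 ^ t * #|F|].
Proof.
move=> T0 DE dC TN C0 FT; elim=> [|t IHt] tC.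
  exists set0; split.
  - by apply/forall_inP => e; rewrite inE.
  - apply/girth_gtP => l _; apply/existsPn => v; apply/existsPn => w.
    apply/negP=> /and4P[l1 _ _ /forallP/(_ (Ordinal (ltnW l1)))].
    by rewrite inE.
  - move=> x; rewrite (_ : edges_at _ _ = set0) ?cards0 //.
    by apply/setP=> e; rewrite !inE.
  - by rewrite cards0.
  - by rewrite !mul1n subset_leq_card //; apply/subsetP=> P; rewrite inE => /andP[].
have [E [uE gE dE cE mE]] := IHt (ltnW tC).
(* With no pair left to serve, the hypergraph stays as it is. *)
have [F0|F0] := eqVneq (missed F E) set0.
  by exists E; split=> //; [exact: leq_trans cE _ | rewrite F0 cards0 muln0].
have := card_crowded d uE; set H := [set x | _] => cH.
have [||e [ek ed ef eF]] := @exists_good_edge E (missed F E) k d L r T0 uE dE _ F0.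
- rewrite -/H; suff : 4 * r * #|H| <= #|T| by nia.
  have h1 : #|E| * k.+1 <= C * #|T| * k.+1.
    by rewrite leq_mul2r (leq_trans cE (ltnW tC)) orbT.
  have h2 : (4 * r * k.+1 * C) * #|H| <= d * #|H| by rewrite leq_mul2r dC orbT.
  have h3 := leq_trans h2 (leq_trans cH h1).
  rewrite -(@leq_pmul2l (k.+1 * C)); last by rewrite muln_gt0.
  by apply: leq_trans (leq_trans _ h3) _; lia.
- by move=> P; rewrite inE => /andP[/FT].
exists (e |: E); split.
- apply/forall_inP=> e'; rewrite in_setU1 => /orP[/eqP->|]; first by rewrite ek.
  by move/forall_inP: uE; apply.
- exact: girth_gt_add.
- move=> x; have [xe|xe] := boolP (x \in e).
    apply: leq_trans (ed x xe); rewrite -add1n.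
    apply: (@leq_trans #|e |: edges_at E x|); last first.
      by rewrite cardsU1 leq_add2r; case: (_ \notin _).
    by apply: subset_leq_card; apply/subsetP=> e'; rewrite !inE; case: eqP.
  apply: leq_trans (dE x); apply: subset_leq_card; apply/subsetP=> e'.
  by rewrite !inE; case: eqP => // ->; rewrite (negbTE xe).
- by apply: leq_trans (leq_card_setU _ _) _; rewrite cards1 add1n.
set hit := [set P in _ | _] in eF.
have mm : #|missed F E| = #|hit| + #|missed F (e |: E)|.
  rewrite -(cardsID hit) (setIidPr _); last first.
    by apply/subsetP=> P; rewrite inE => /andP[].
  congr (_ + _); apply: eq_card; apply/setP.
  apply/setP=> P; rewrite !inE; case: (P \in F) => //=; rewrite ?andbF //.
  apply/andP/forall_inP => [[+ h2] e'|h].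
    rewrite h2 /= => h1; rewrite in_setU1 => /orP[/eqP-> //|].
    by move/forall_inP: h2; apply.
  have hE : [forall e0 in E, ~~ hits e0 P].
    by apply/forall_inP=> e' e'E; apply: h; rewrite in_setU1 e'E orbT.
  by rewrite hE h // setU11.
rewrite -DE in eF.
have D1 : D * #|missed F (e |: E)| <= D.-1 * #|missed F E|.
  by rewrite mm; move: eF; rewrite mm; nia.
rewrite !expnS; apply: (@leq_trans (D ^ t * (D.-1 * #|missed F E|))).
  by rewrite mulnAC mulnC leq_mul2l D1 orbT.
by rewrite mulnCA -mulnA leq_mul2l mE orbT.
Qed.

End Greedy.

(** Bernoulli: (1 + 1/n)^n >= 2. *)
Lemma expn_succ_double n : 0 < n -> 2 * n ^ n <= n.+1 ^ n.
Proof.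
move=> n0; have H m : n ^ m.+1 + m.+1 * n ^ m <= n.+1 ^ m.+1.
  elim: m => [|m IHm]; first by rewrite !expn1 expn0; lia.
  rewrite [n.+1 ^ _]expnS; move: IHm; rewrite !expnS; nia.
by have := H n.-1; rewrite prednK // -expnS prednK //; lia.
Qed.

(** The number of pairs is at most 4^N, so C is chosen with 4 (1 - 1/D)^C < 1:
    for D = n + 1, three applications of [expn_succ_double] give
    D^(3n) >= 8 n^(3n). *)
Lemma exists_mixing_hypergraph k r L : 0 < k -> 0 < r ->
  exists (T : finType) (E : {set {set T}}),
    [/\ 4 <= #|T|, uniform k E, girth_gt E L
      & forall A B : {set T}, #|T| <= r * #|A| -> #|T| <= r * #|B| ->
        exists2 e, e \in E & hits e (A, B)].
Proof.
case: k => // k _ r0.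
pose n := ((2 * r) ^ k.+1).-1.
have nE : n.+1 = (2 * r) ^ k.+1 by rewrite prednK // expn_gt0 muln_gt0 r0.
have n0 : 0 < n.
  rewrite -ltnS nE; apply: (@leq_trans (2 * r)); first lia.
  by rewrite -{1}[2 * r]expn1 leq_pexp2l // muln_gt0 r0.
pose C := 3 * n; pose d := 4 * r * k.+1 * C.
pose N := 4 * r * k.+1 * (d * k.+1).+1 ^ L.
have N4 : 4 <= N.
  have : 0 < (d * k.+1).+1 ^ L by rewrite expn_gt0.
  by rewrite /N; set x := _ ^ L; nia.
have Cn : 4 * n ^ C < n.+1 ^ C.
  rewrite /C (mulnC 3) !expnM; set x := n ^ n; set y := n.+1 ^ n.
  have xy : 2 * x <= y by exact: expn_succ_double.
  have x0 : 0 < x by rewrite expn_gt0 n0.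
  apply: (@leq_trans ((2 * x) ^ 3)); last by rewrite leq_exp2r.
  rewrite expnMn; have : 0 < x ^ 3 by rewrite expn_gt0 x0.
  set z := x ^ 3; lia.
pose F := [set P : {set 'I_N} * {set 'I_N} | (N <= r * #|P.1|) && (N <= r * #|P.2|)].
have [|||||E [uE gE _ _ mE]] := @exists_greedy_hypergraph 'I_N k d C n.+1 L r F
    _ nE (leqnn _) _ _ _ (C * N); rewrite ?card_ord //.
- by lia.
- by rewrite muln_gt0 n0.
- by move=> P; rewrite inE => /andP[].
exists 'I_N, E; split; rewrite ?card_ord // => A B hA hB.
have cF : #|F| <= 4 ^ N.
  apply: leq_trans (max_card _) _.
  by rewrite card_prod -cardsT -powersetT card_powerset cardsT card_ord -expnMn.
have m0 : missed F E = set0.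
  apply/eqP; rewrite -cards_eq0 -leqn0 -ltnS.
  rewrite -(@ltn_pmul2l (n.+1 ^ (C * N))) ?expn_gt0 // muln1.
  apply: leq_ltn_trans mE _; apply: (@leq_ltn_trans (n ^ (C * N) * 4 ^ N)).
    by rewrite leq_mul2l cF orbT.
  rewrite (expnM n) (expnM n.+1) -expnMn ltn_exp2r; last by lia.
  by rewrite mulnC.
apply/exists_inP; apply: contraT => nex.
suff : (A, B) \in missed F E by rewrite m0 inE.
rewrite !inE hA hB /=; apply/forall_inP=> e eE; apply: contra nex => he.
by apply/exists_inP; exists e.
Qed.

(** * Stopping sets *)

Section Stopping.
Variable T : finType.
Implicit Types (E : {set {set T}}) (S : {set T}).

(** These are the stopping sets of coding theory, with the edges as checks. *)
Definition stopping E S := [forall e in E, #|e :&: S| != 1].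

Lemma stopping0 E : stopping E set0.
Proof. by apply/forall_inP=> e _; rewrite setI0 cards0. Qed.

(** An edge that meets the union once meets each part at most once, hence not at
    all as both parts are stopping. *)
Lemma stoppingU E S S' : stopping E S -> stopping E S' -> stopping E (S :|: S').
Proof.
move=> /forall_inP h /forall_inP h'; apply/forall_inP=> e eE.
apply: contraNneq (h e eE) => c1.
have [le lS] : #|e :&: S| <= 1 /\ #|e :&: S'| <= 1.
  by rewrite -c1 !subset_leq_card // setIS ?subsetUl ?subsetUr.
have := h' e eE; have := leq_card_setU (e :&: S) (e :&: S').
rewrite -setIUr c1 => -[+ _]; lia.
Qed.

Lemma hits_stoppingF E S e : e \in E -> hits e (S, ~: S) -> ~~ stopping E S.
Proof.
move=> eE /exists_inP[x xe /andP[/= xS sub]]; apply/forall_inPn; exists e => //.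
rewrite negbK; apply/cards1P; exists x; apply/setP=> y; rewrite !inE.
have [->|yx] := eqVneq y x; first by rewrite xe.
apply/negbTE/andP=> -[ye yS]; move/subsetP: sub => /(_ y).
by rewrite !inE yx ye yS => /(_ isT).
Qed.

End Stopping.

(** * Deleting a stopping set *)

Section Deletion.
Variables (T : finType) (S0 : {set T}).
Implicit Types (E : {set {set T}}) (S : {set T}).

Let W : finType := {x : T | x \notin S0}.

Definition delete_vertices E : {set {set W}} := [set e : {set W} | val @: e \in E].

Lemma val_imset_sub (e : {set T}) (U : {set W}) :
  e \subset val @: U -> exists2 e' : {set W}, val @: e' = e & e' \subset U.
Proof.
move=> eU; exists (val @^-1: e); last first.
  apply/subsetP=> x; rewrite inE => /(subsetP eU)/imsetP[y yU /val_inj->//].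
apply/setP=> x; apply/imsetP/idP=> [[y + ->]|xe]; first by rewrite inE.
by have /imsetP[y _ xy] := subsetP eU x xe; exists y; rewrite ?inE -?xy.
Qed.

Lemma card_val_imset (U : {set W}) : #|val @: U| = #|U|.
Proof. by rewrite card_imset //; exact: val_inj. Qed.

Lemma uniform_delete E k : uniform k E -> uniform k (delete_vertices E).
Proof.
move=> /forall_inP uE; apply/forall_inP=> e; rewrite inE => /uE.
by rewrite card_val_imset.
Qed.

Lemma girth_gt_delete E L : girth_gt E L -> girth_gt (delete_vertices E) L.
Proof.
move=> /girth_gtP gE; apply/girth_gtP => l /gE; apply: contraNN.
case/existsP=> v /existsP[w /and4P[l1 /injectiveP vI /injectiveP wI /forallP inc]].
apply/existsP; exists [ffun i => val (v i)].
apply/existsP; exists [ffun i => val @: w i]; apply/and4P; split=> //.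
- by apply/injectiveP=> i j; rewrite !ffunE => /val_inj/vI.
- by apply/injectiveP=> i j; rewrite !ffunE => /(imset_inj val_inj)/wI.
- apply/forallP=> i; rewrite !ffunE; have := inc i.
  by rewrite inE => /and3P[-> h1 h2]; rewrite !imset_f.
Qed.

(** An edge that meets the union once cannot meet S0, since it would do so at
    least twice; it therefore survives the deletion, and meets S once. *)
Lemma stopping_delete E (S : {set W}) :
    stopping E S0 -> stopping (delete_vertices E) S ->
  stopping E (S0 :|: val @: S).
Proof.
move=> /forall_inP st0 /forall_inP st; apply/forall_inP=> e eE.
apply/eqP=> c1.
have e0 : e :&: S0 = set0.
  apply/eqP; rewrite -cards_eq0; have := st0 e eE.
  have : #|e :&: S0| <= 1 by rewrite -c1 subset_leq_card // setIS ?subsetUl.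
  lia.
have [|e' e'E _] := @val_imset_sub e setT.
  apply/subsetP=> x xe; have xS : x \notin S0.
    by apply/negP=> xS; move/setP/(_ x): e0; rewrite !inE xe xS.
  by apply/imsetP; exists (Sub x xS); rewrite ?inE ?SubK.
have := st e'; rewrite inE e'E eE => /(_ isT).
rewrite -card_val_imset imsetI ?e'E; last by move=> ? ? _ _; exact: val_inj.
by move: c1; rewrite setIUr e0 set0U => ->.
Qed.

Lemma card_delete : #|W| = #|T| - #|S0|.
Proof.
by rewrite card_sig -(cardsC S0) addKn; apply: eq_card => x; rewrite !inE.
Qed.

End Deletion.

(** * The hypergraph without small stopping sets *)

Local Open Scope ring_scope.

Theorem lemma6p1 (k q L : nat)
    (hk : (3 <= k)%N) (hq : (2 <= q)%N) (hL : (2 <= L)%N) :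
  exists (V : finType) (E : {set {set V}}),
    [/\ uniform k E,
        girth_gt E L,
        (forall x : V, ~~ isolated E x),
        (forall U : {set V}, #|V|%:R / q%:R <= #|U|%:R :> rat ->
           exists2 e, e \in E & e \subset U)
      & (forall S : {set V}, S != set0 ->
           #|S|%:R <= (1 - 1 / q%:R) * #|V|%:R :> rat ->
           exists2 e, e \in E & #|e :&: S| = 1%N)].
Proof.
have q0 : 0 < q%:R :> rat by rewrite ltr0n; lia.
have [||T [E [T4 uE gE mixE]]] := @exists_mixing_hypergraph k (2 * q) L; [lia|lia|].
pose small S := stopping E S && (2 * q * #|S| < #|T|)%N.
have small_of S : stopping E S -> (#|T| <= 2 * q * #|~: S|)%N -> small S.
  move=> st cS; rewrite /small st ltnNge; apply/negP => hS.
  by have [e eE /(hits_stoppingF eE)/negP[]] := mixE _ _ hS cS.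
have smallU S S' : small S -> small S' -> small (S :|: S').
  move=> /andP[st c] /andP[st' c']; apply: small_of; first exact: stoppingU.
  have cU : (2 * q * #|S :|: S'| <= 2 * q * #|S| + 2 * q * #|S'|)%N.
    by rewrite -mulnDr leq_mul2l leq_card_setU orbT.
  have q4 : (4 * #|T| <= 2 * q * #|T|)%N by rewrite leq_mul2r; lia.
  by move: q4; rewrite -{2}(cardsC (S :|: S')) mulnDr; lia.
pose S0 := \bigcup_(S | small S) S.
have sS0 : small S0.
  rewrite /S0; elim/big_ind: _ => //; rewrite /small stopping0 cards0 muln0.
  exact: leq_trans T4.
have [st0 c0] := andP sS0.
pose V : finType := {x : T | x \notin S0}.
have cV : #|V| = (#|T| - #|S0|)%N := card_delete S0.
have cV2 : (#|T| <= 2 * #|V|)%N by rewrite cV; nia.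
have exact_one (S : {set V}) : S != set0 -> (q * #|S| + #|V| <= q * #|V|)%N ->
    exists2 e, e \in delete_vertices S0 E & #|e :&: S| = 1%N.
  move=> /set0Pn[x xS] cS.
  suff : ~~ stopping (delete_vertices S0 E) S.
    by case/forall_inPn => e eE; rewrite negbK => /eqP; exists e.
  apply/negP=> /(stopping_delete st0) st.
  have sm : small (S0 :|: val @: S).
    apply: small_of => //; set Z := ~: _.
    have cZ : (#|V| <= #|S| + #|Z|)%N.
      have := cardsC (S0 :|: val @: S).
      have [+ _] := leq_card_setU S0 (val @: S); rewrite card_val_imset cV -/Z => cU <-.
      by rewrite leq_subLR addnA leq_add2r.
    have : (q * #|V| <= q * #|S| + q * #|Z|)%N by rewrite -mulnDr leq_mul2l cZ orbT.
    lia.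
  have sub : S0 :|: val @: S \subset S0 by exact: (bigcup_sup _ sm).
  have := subsetP sub (val x); rewrite inE imset_f // orbT => /(_ isT).
  by rewrite (negbTE (valP x)).
exists V, (delete_vertices S0 E); split.
- exact: uniform_delete.
- exact: girth_gt_delete.
- move=> x; have [||e eE /eqP/cards1P[y ey]] := exact_one [set x].
  + by apply/set0Pn; exists x; rewrite inE.
  + by rewrite cards1; nia.
  + apply/forall_inPn; exists e => //; rewrite negbK.
    by have := set11 y; rewrite -ey !inE => /andP[+ /eqP <-].
- move=> U; rewrite ler_pdivrMr // -natrM ler_nat => cU.
  have hU : (#|T| <= 2 * q * #|val @: U|)%N.
    rewrite card_val_imset; apply: (leq_trans cV2).
    by rewrite -mulnA leq_mul2l (mulnC q) cU orbT.
  have [e eE /exists_inP[x xe /andP[/= xU sub]]] := mixE _ _ hU hU.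
  have [|e' e'E e'U] := @val_imset_sub _ S0 e U.
    by rewrite -(setD1K xe) subUset sub1set xU.
  by exists e' => //; rewrite inE e'E.
- move=> S S0' cS; apply: exact_one => //.
  move: cS; rewrite -(ler_pM2l q0) mulrA mulrBr mulr1 mulrCA divff ?gt_eqF //.
  by rewrite mulr1 mulrBl mul1r lerBrDr -!natrM -natrD ler_nat.
Qed.
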